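(* Let $\{\mathbf{w}^k\}$ and $\{\widetilde{\mathbf{w}}^k\}$ be the sequences generated by GS-ADMM(a) (the case $p\ge1$, $q=1$, $\sigma_2=0$). For any $\sigma_1\in(p-1,+\infty)$ and $(\tau,s)\in\mathcal{K}_1$, where $$\mathcal{K}_1=\{(\tau,s)\in\mathbb{R}^2:\ \tau+s>0,\ \tau<1,\ -\tau^2-s^2-\tau s+\tau+s+1>0\},$$ we have $$\lim_{k\to\infty}\sum_{i=1}^p\|A_i(x_i^k-x_i^{k+1})\|^2=0\quad\text{and}\quad\lim_{k\to\infty}\|\mathcal{A}\mathbf{x}^k+By^k-c\|=0,$$ and there exists $\mathbf{w}^\infty\in\mathcal{M}^*$ such that $\lim_{k\to\infty}\widetilde{\mathbf{w}}^k=\mathbf{w}^\infty$.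
   Context: Setting. $p\ge1$ is an integer; $f_i:\mathbb{R}^{m_i}\to\mathbb{R}$ ($1\le i\le p$) and $g:\mathbb{R}^{d}\to\mathbb{R}$ are closed proper convex functions; $A_i\in\mathbb{R}^{n\times m_i}$ and $B\in\mathbb{R}^{n\times d}$ all have full column rank; $c\in\mathbb{R}^n$; $\mathcal{X}_i\subset\mathbb{R}^{m_i}$, $\mathcal{Y}\subset\mathbb{R}^{d}$ are closed convex sets. The problem is: minimize $\sum_i f_i(x_i)+g(y)$ subject to $\sum_i A_ix_i+By=c$, $x_i\in\mathcal{X}_i$, $y\in\mathcal{Y}$; its solution set is assumed nonempty. Notation. $\mathcal{A}=(A_1,\dots,A_p)$, $\mathbf{x}=(x_1;\dots;x_p)$, $\mathcal{X}=\prod_i\mathcal{X}_i$, $\mathcal{M}=\mathcal{X}\times\mathcal{Y}\times\mathbb{R}^n$, $\mathbf{u}=(\mathbf{x};y)$, $\mathbf{w}=(\mathbf{x};y;\lambda)$, $h(\mathbf{u})=\sum_{i=1}^pf_i(x_i)+g(y)$, $\mathcal{J}(\mathbf{w})=(-\mathcal{A}^{\sf T}\lambda;\,-B^{\sf T}\lambda;\,\mathcal{A}\mathbf{x}+By-c)$. For $\beta>0$, $\mathcal{L}_\beta(\mathbf{x},y,\lambda)=h(\mathbf{u})-\langle\lambda,\mathcal{A}\mathbf{x}+By-c\rangle+\frac{\beta}{2}\|\mathcal{A}\mathbf{x}+By-c\|^2$. $\mathcal{M}^*$ is the set of $\mathbf{w}^*\in\mathcal{M}$ with $h(\mathbf{u})-h(\mathbf{u}^*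 )+\langle\mathbf{w}-\mathbf{w}^*,\mathcal{J}(\mathbf{w}^* )\rangle\ge0$ for all $\mathbf{w}\in\mathcal{M}$. GS-ADMM(a) (parameters $\beta>0,\sigma_1,\tau,s$). From an initial $\mathbf{w}^0=(\mathbf{x}^0;y^0;\lambda^0)\in\mathcal{M}$, for $k=0,1,2,\dots$: (1) for each $i$, $x_i^{k+1}=\arg\min_{x_i\in\mathcal{X}_i}\mathcal{L}_\beta(x_1^k,\dots,x_i,\dots,x_p^k,y^k,\lambda^k)+\frac{\sigma_1\beta}{2}\|A_i(x_i-x_i^k)\|^2$; (2) $\lambda^{k+\frac12}=\lambda^k-\tau\beta(\mathcal{A}\mathbf{x}^{k+1}+By^k-c)$; (3) $y^{k+1}=\arg\min_{y\in\mathcal{Y}}\mathcal{L}_\beta(\mathbf{x}^{k+1},y,\lambda^{k+\frac12})$; (4) $\lambda^{k+1}=\lambda^{k+\frac12}-s\beta(\mathcal{A}\mathbf{x}^{k+1}+By^{k+1}-c)$. Here $\mathbf{w}^k=(\mathbf{x}^k;y^k;\lambda^k)$, and $\widetilde{\mathbf{w}}^k=(\mathbf{x}^{k+1};y^{k+1};\widetilde\lambda^k)$ with $\widetilde\lambda^k=\lambda^k-\beta(\mathcal{A}\mathbf{x}^{k+1}+By^k-c)$.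
   Formalization: The formal theorem additionally assumes that M* is nonempty (a primal-dual solution exists); nonemptiness of the solution set of the minimization problem alone does not guarantee this, and the claim fails without it. *)

(* Defs.v *)
From HB Require Import structures.
From mathcomp Require Import all_boot all_order all_algebra.
From mathcomp Require Import all_classical all_reals all_analysis.

Set Implicit Arguments.
Unset Strict Implicit.
Unset Printing Implicit Defensive.

Import Order.TTheory GRing.Theory Num.Theory.
Import numFieldNormedType.Exports.

Local Open Scope classical_set_scope.
Local Open Scope ring_scope.

Section Euclidean.
Variables (R : realType) (m : nat).

Definition dotmul (u v : 'cV[R]_m) : R := \sum_i u i 0 * v i 0.

(* The library norm `|u| on matrices is the max norm, hence this one. *)
Definition enorm (u : 'cV[R]_m) : R := Num.sqrt (dotmul u u).

End Euclidean.

Section ConvexAnalysis.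
Variables (R : realType) (m : nat).

Definition epigraph (f : 'cV[R]_m -> R) : set ('cV[R]_m * R) :=
  [set z | f z.1 <= z.2].

Definition proper_function (F : 'cV[R]_m -> \bar R) : Prop :=
  (forall x, F x != -oo%E) /\ (exists x, (F x < +oo)%E).

(* Properness always holds for a real-valued [f]. *)
Definition closed_proper_convex (f : 'cV[R]_m -> R) : Prop :=
  [/\ closed (epigraph f),
      proper_function (EFin \o f) &
      @convex_function R 'cV[R]_m setT f].

Definition is_argmin (D : set 'cV[R]_m) (F : 'cV[R]_m -> R) (z : 'cV[R]_m)
  : Prop := D z /\ forall z', D z' -> F z <= F z'.

End ConvexAnalysis.

Record admm_data (R : realType) (p n d : nat) (m : 'I_p -> nat) := AdmmData {
  fun_x : forall i : 'I_p, 'cV[R]_(m i) -> R;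
  fun_y : 'cV[R]_d -> R;
  mat_x : forall i : 'I_p, 'M[R]_(n, m i);
  mat_y : 'M[R]_(n, d);
  rhs : 'cV[R]_n;
  dom_x : forall i : 'I_p, set 'cV[R]_(m i);
  dom_y : set 'cV[R]_d
}.
Arguments fun_x {R p n d m} P i _ : rename.
Arguments mat_x {R p n d m} P i : rename.
Arguments dom_x {R p n d m} P i _ : rename.

(* A point is a stacked column: x = (x_1; ...; x_p) is \mxcol_i x_i,
   u = (x; y) and w = ((x; y); lambda). *)
Section GSADMM.
Variables (R : realType) (p n d : nat) (m : 'I_p -> nat).
Variable P : admm_data R n d m.

Notation xspace := 'cV[R]_(\sum_i m i).
Notation uspace := 'cV[R]_(\sum_i m i + d).
Notation wspace := 'cV[R]_(\sum_i m i + d + n).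

Definition wstack (x : xspace) (y : 'cV[R]_d) (l : 'cV[R]_n) : wspace :=
  col_mx (col_mx x y) l.
Definition u_of (w : wspace) : uspace := usubmx w.
Definition x_of (w : wspace) : xspace := usubmx (u_of w).
Definition y_of (w : wspace) : 'cV[R]_d := dsubmx (u_of w).
Definition l_of (w : wspace) : 'cV[R]_n := dsubmx w.

Definition calA : 'M[R]_(n, \sum_i m i) := \mxrow_i mat_x P i.

Definition residual (x : xspace) (y : 'cV[R]_d) : 'cV[R]_n :=
  calA *m x + mat_y P *m y - rhs P.

Definition objective (u : uspace) : R :=
  \sum_i fun_x P i (submxcol (usubmx u) i) + fun_y P (dsubmx u).

Definition calX : set xspace := [set x | forall i, dom_x P i (submxcol x i)].

Definition calM : set wspace :=
  [set w | calX (x_of w) /\ dom_y P (y_of w)].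

Definition calJ (w : wspace) : wspace :=
  wstack (- (calA^T *m l_of w)) (- ((mat_y P)^T *m l_of w))
         (residual (x_of w) (y_of w)).

Definition feasible_set : set uspace :=
  [set u | [/\ calX (usubmx u), dom_y P (dsubmx u) &
              calA *m usubmx u + mat_y P *m dsubmx u = rhs P]].

Definition solution_set : set uspace :=
  [set u | feasible_set u /\
           forall v, feasible_set v -> objective u <= objective v].

Definition Mstar : set wspace :=
  [set ws | calM ws /\ forall w, calM w ->
     0 <= objective (u_of w) - objective (u_of ws)
          + dotmul (w - ws) (calJ ws)].

Definition aug_lagrangian (beta : R)
    (x : xspace) (y : 'cV[R]_d) (l : 'cV[R]_n) : R :=
  objective (col_mx x y) - dotmul l (residual x y)
  + beta / 2 * enorm (residual x y) ^+ 2.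

Definition set_block (x : xspace) (i : 'I_p) (z : 'cV[R]_(m i)) : xspace :=
  \mxcol_j dfwith (submxcol x) i z j.

Definition gs_admm_a (beta sigma1 tau s : R) (w : nat -> wspace) : Prop :=
  calM (w 0) /\
  forall k : nat,
    let x := x_of (w k) in let x' := x_of (w k.+1) in
    let y := y_of (w k) in let y' := y_of (w k.+1) in
    let l := l_of (w k) in let l' := l_of (w k.+1) in
    let lhalf := l - (tau * beta) *: residual x' y in
    [/\ forall i, is_argmin (dom_x P i)
          (fun z => aug_lagrangian beta (set_block x z) y l
             + sigma1 * beta / 2
               * enorm (mat_x P i *m (z - submxcol x i)) ^+ 2)
          (submxcol x' i),
        is_argmin (dom_y P) (fun z => aug_lagrangian beta x' z lhalf) y' &
        l' = lhalf - (s * beta) *: residual x' y'].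

Definition wtilde (beta : R) (w : nat -> wspace) (k : nat) : wspace :=
  wstack (x_of (w k.+1)) (y_of (w k.+1))
         (l_of (w k) - beta *: residual (x_of (w k.+1)) (y_of (w k))).

End GSADMM.

Definition calK1 (R : realType) : set (R * R) :=
  [set ts | [/\ 0 < ts.1 + ts.2, ts.1 < 1 &
    0 < - ts.1 ^+ 2 - ts.2 ^+ 2 - ts.1 * ts.2 + ts.1 + ts.2 + 1]].

(* Main.v *)
(* Fix a saddle point ws = (xs; ys; lambdas) and measure the iterates by
   a_i = A_i (x_i - xs_i), b = B (y - ys) and
   nu = (lambda - lambdas) / beta - tau b.  Adding the
   first-order conditions of the subproblems and the saddle inequality shows
   that, along the iteration, the positive definite quadratic form
     E = (sigma1 + 1) sum |a_i|^2 - |sum a_i|^2 + (1 - tau) |b|^2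
         + |nu|^2 / (tau + s)
   decreases by a form in the steps and the new residual r', up to the cross
   term 2 (1 - tau) <B (y - y'), r'>.  The optimality conditions of two
   consecutive y-steps bound this term below, at the price of adding
   kappa |r|^2 to E; on K_1 the remaining decrease is positive definite.  Hence
   the steps and the residual vanish and the iterates stay bounded.  A limit
   along an ultrafilter is a saddle point because the epigraphs are closed, and
   repeating the argument with this limit as ws gives full convergence. *)

Require Import Defs.
From HB Require Import structures.
From mathcomp Require Import all_boot all_order all_algebra.
From mathcomp Require Import all_classical all_reals all_analysis.
From mathcomp Require Import ring lra.

Set Implicit Arguments.
Unset Strict Implicit.
Unset Printing Implicit Defensive.

Import Order.TTheory GRing.Theory Num.Theory.
Import numFieldNormedType.Exports.

Local Open Scope classical_set_scope.
Local Open Scope ring_scope.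

(** * Dot products *)

Section DotProduct.
Variables (R : realType).
Implicit Type n : nat.

Lemma dotmulC n (u v : 'cV[R]_n) : dotmul u v = dotmul v u.
Proof. by apply: eq_bigr => i _; rewrite mulrC. Qed.

Lemma dotmulDl n (u v w : 'cV[R]_n) :
  dotmul (u + v) w = dotmul u w + dotmul v w.
Proof.
by rewrite /dotmul -big_split /=; apply: eq_bigr => i _; rewrite mxE mulrDl.
Qed.

Lemma dotmulZl n a (u w : 'cV[R]_n) : dotmul (a *: u) w = a * dotmul u w.
Proof.
by rewrite /dotmul big_distrr /=; apply: eq_bigr => i _; rewrite mxE mulrA.
Qed.

Lemma dotmulNl n (u w : 'cV[R]_n) : dotmul (- u) w = - dotmul u w.
Proof. by rewrite -scaleN1r dotmulZl mulN1r. Qed.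

Lemma dotmulDr n (u v w : 'cV[R]_n) :
  dotmul w (u + v) = dotmul w u + dotmul w v.
Proof. by rewrite dotmulC dotmulDl !(dotmulC w). Qed.

Lemma dotmulZr n a (u w : 'cV[R]_n) : dotmul w (a *: u) = a * dotmul w u.
Proof. by rewrite dotmulC dotmulZl (dotmulC w). Qed.

Lemma dotmulNr n (u w : 'cV[R]_n) : dotmul w (- u) = - dotmul w u.
Proof. by rewrite dotmulC dotmulNl (dotmulC w). Qed.

Lemma dotmul0l n (w : 'cV[R]_n) : dotmul 0 w = 0.
Proof. by rewrite -(scale0r 0) dotmulZl mul0r. Qed.

Lemma dotmul0r n (w : 'cV[R]_n) : dotmul w 0 = 0.
Proof. by rewrite dotmulC dotmul0l. Qed.

Definition dotmulE := (dotmulDl, dotmulDr, dotmulNl, dotmulNr, dotmulZl,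
  dotmulZr, dotmul0l, dotmul0r).

Lemma dotmul_suml n (I : Type) (r : seq I) (P : pred I) (F : I -> 'cV[R]_n) w :
  dotmul (\sum_(i <- r | P i) F i) w = \sum_(i <- r | P i) dotmul (F i) w.
Proof.
by elim/big_rec2: _ => [|i x y _ <-]; rewrite ?dotmul0l ?dotmulDl.
Qed.

Lemma dotmul_sumr n (I : Type) (r : seq I) (P : pred I) (F : I -> 'cV[R]_n) w :
  dotmul w (\sum_(i <- r | P i) F i) = \sum_(i <- r | P i) dotmul w (F i).
Proof.
by elim/big_rec2: _ => [|i x y _ <-]; rewrite ?dotmul0r ?dotmulDr.
Qed.

Lemma dotmul_ge0 n (u : 'cV[R]_n) : 0 <= dotmul u u.
Proof. by apply: sumr_ge0 => i _; rewrite -expr2 sqr_ge0. Qed.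

Lemma sqr_coord_le_dotmul n (u : 'cV[R]_n) i : u i 0 ^+ 2 <= dotmul u u.
Proof.
rewrite /dotmul (bigD1 i) //= -expr2 lerDl.
by apply: sumr_ge0 => j _; rewrite -expr2 sqr_ge0.
Qed.

Lemma dotmul_eq0 n (u : 'cV[R]_n) : dotmul u u <= 0 -> u = 0.
Proof.
move=> u0; apply/colP => i; rewrite mxE; apply/eqP.
rewrite -sqrf_eq0 eq_le sqr_ge0 andbT.
exact: le_trans (sqr_coord_le_dotmul u i) u0.
Qed.

Lemma sqr_enorm n (u : 'cV[R]_n) : enorm u ^+ 2 = dotmul u u.
Proof. by rewrite sqr_sqrtr // dotmul_ge0. Qed.

Lemma dotmul_mulmx n k (A : 'M[R]_(n, k)) u v :
  dotmul u (A^T *m v) = dotmul (A *m u) v.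
Proof.
rewrite /dotmul.
under eq_bigr do rewrite mxE big_distrr /=.
under [RHS]eq_bigr do rewrite mxE big_distrl /=.
rewrite exchange_big; apply: eq_bigr => i _; apply: eq_bigr => j _.
by rewrite mxE mulrCA mulrA.
Qed.

Lemma dotmul_col_mx n k (u u' : 'cV[R]_n) (v v' : 'cV[R]_k) :
  dotmul (col_mx u v) (col_mx u' v') = dotmul u u' + dotmul v v'.
Proof.
rewrite /dotmul big_split_ord /=; congr (_ + _); apply: eq_bigr => i _.
  by rewrite !col_mxEu.
by rewrite !col_mxEd.
Qed.

(** Each of the [p ^ 2] products is at most half the sum of the two squares. This bound is the
    source of the threshold [p - 1] for [sigma]. *)
Lemma dotmul_sum_le n p (a : 'I_p -> 'cV[R]_n) :
  dotmul (\sum_i a i) (\sum_i a i) <= p%:R * \sum_i dotmul (a i) (a i).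
Proof.
rewrite dotmul_suml.
apply: (@le_trans _ _
  (\sum_i \sum_j (dotmul (a i) (a i) + dotmul (a j) (a j)) / 2)).
  apply: ler_sum => i _; rewrite dotmul_sumr; apply: ler_sum => j _.
  have := dotmul_ge0 (a i - a j).
  by rewrite !dotmulE (dotmulC (a j) (a i)); lra.
set X := \sum_i dotmul (a i) (a i).
under eq_bigr => i _.
  rewrite -big_distrl big_split /= sumr_const card_ord -/X.
  rewrite -[_ *+ p]mulr_natl; over.
rewrite -big_distrl big_split /= -big_distrr /= sumr_const card_ord -/X.
by rewrite -[_ *+ p]mulr_natl; lra.
Qed.

End DotProduct.

(** * Limits of vector sequences *)

Section Limits.
Variables (R : realType) (T : Type) (F : set_system T).
Context {FF : ProperFilter F}.
Implicit Types n m : nat.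

Lemma cvg_mx_coord n m (v : T -> 'M[R]_(n, m)) (l : 'M[R]_(n, m)) :
  (forall i j, (fun t => v t i j) @ F --> l i j) -> v @ F --> l.
Proof.
move=> vl A [P lP PA].
have FP : \forall t \near F, forall ij, P ij.1 ij.2 (v t ij.1 ij.2).
  by apply: filter_forall => -[i j]; exact: vl (lP i j).
by apply: filterS FP => t Pt; apply: PA => i j; exact: (Pt (i, j)).
Qed.

Lemma cvg_coord n m (v : T -> 'M[R]_(n, m)) (l : 'M[R]_(n, m)) i j :
  v @ F --> l -> (fun t => v t i j) @ F --> l i j.
Proof. by move=> vl; exact: cvg_comp vl (@coord_continuous _ _ _ i j l). Qed.

Lemma cvg_sum_ord (V : normedModType R) k (f : 'I_k -> T -> V) (l : 'I_k -> V) :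
  (forall i, f i @ F --> l i) ->
  (fun t => \sum_i f i t) @ F --> \sum_i l i.
Proof. by move=> fl; apply: cvg_big => //; exact: add_continuous. Qed.

Lemma cvg_mulmx n m (C : 'M[R]_(n, m)) (v : T -> 'cV[R]_m) (l : 'cV[R]_m) :
  v @ F --> l -> (fun t => C *m v t) @ F --> C *m l.
Proof.
move=> vl; apply: cvg_mx_coord => i j; rewrite mxE.
rewrite [X in X @ _](_ : _ = fun t => \sum_k C i k * v t k j); last first.
  by apply/funext => t; rewrite mxE.
apply: cvg_sum_ord => k.
by apply: cvgMl_tmp; exact: cvg_coord.
Qed.

Lemma cvg_dotmul n (u v : T -> 'cV[R]_n) (a b : 'cV[R]_n) :
  u @ F --> a -> v @ F --> b ->
  (fun t => dotmul (u t) (v t)) @ F --> dotmul a b.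
Proof.
move=> ua vb; apply: cvg_sum_ord => i.
by apply: cvgM; exact: cvg_coord.
Qed.

(** Passes from Euclidean norms to the coordinatewise topology of matrices: each coordinate is
    squeezed by the square root of the dot product. *)
Lemma cvg_dotmul0 n (v : T -> 'cV[R]_n) :
  (fun t => dotmul (v t) (v t)) @ F --> (0 : R) -> v @ F --> (0 : 'cV[R]_n).
Proof.
move=> v0; apply: cvg_mx_coord => i j; rewrite mxE ord1.
have e0 : (fun t => enorm (v t)) @ F --> (0 : R).
  rewrite -(sqrtr0 R); exact: cvg_comp v0 (@sqrt_continuous R 0).
apply: norm_cvg0.
apply: (@squeeze_cvgr _ _ _ _ (cst 0) (fun t => enorm (v t))) => //; last first.
  exact: cvg_cst.
apply: nearW => t /=.
rewrite normr_ge0 /= -(@ler_pXn2r _ 2) ?nnegrE ?sqrtr_ge0 //.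
by rewrite sqr_enorm real_normK ?num_real // sqr_coord_le_dotmul.
Qed.

Lemma cvg_col_mx n m (u : T -> 'cV[R]_n) (v : T -> 'cV[R]_m)
    (a : 'cV[R]_n) (b : 'cV[R]_m) :
  u @ F --> a -> v @ F --> b ->
  (fun t => col_mx (u t) (v t)) @ F --> col_mx a b.
Proof.
move=> ua vb; apply: cvg_mx_coord => i j.
case: (fintype.splitP i) => k ik.
  have -> : i = lshift m k by exact/val_inj.
  rewrite col_mxEu [X in X @ _](_ : _ = fun t => u t k j).
    exact: cvg_coord.
  by apply/funext => t; rewrite col_mxEu.
have -> : i = rshift n k by exact/val_inj.
rewrite col_mxEd [X in X @ _](_ : _ = fun t => v t k j).
  exact: cvg_coord.
by apply/funext => t; rewrite col_mxEd.
Qed.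

Lemma cvg_mxcol p (m : 'I_p -> nat) (u : forall i, T -> 'cV[R]_(m i))
    (a : forall i, 'cV[R]_(m i)) :
  (forall i, u i @ F --> a i) ->
  (fun t => \mxcol_i u i t) @ F --> \mxcol_i a i.
Proof.
move=> ua; apply: cvg_mx_coord => i j; rewrite mxE.
rewrite [X in X @ _](_ : _ = fun t => u (tagnat.sig1 i) t (tagnat.sig2 i) j).
  exact: cvg_coord.
by apply/funext => t; rewrite mxE.
Qed.

Lemma cvg0_le_scaled (c : R) (q e : T -> R) :
  0 < c -> (forall t, 0 <= q t) -> (forall t, c * q t <= e t) ->
  e @ F --> (0 : R) -> q @ F --> (0 : R).
Proof.
move=> c0 q0 qe e0.
apply: (@squeeze_cvgr _ _ _ _ (cst 0) (fun t => c^-1 * e t)).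
- by apply: nearW => t; rewrite /= q0 /= ler_pdivlMl.
- exact: cvg_cst.
- by rewrite -(mulr0 c^-1); exact: cvgMl_tmp.
Qed.

Lemma cvg_scalemx n (c : R) (v : T -> 'cV[R]_n) (l : 'cV[R]_n) :
  v @ F --> l -> (fun t => c *: v t) @ F --> c *: l.
Proof. exact: cvgZl_tmp. Qed.

Lemma cvg_pair_nbhs (U V : topologicalType) (u : T -> U) (v : T -> V)
    (a : U) (b : V) :
  u @ F --> a -> v @ F --> b -> (fun t => (u t, v t)) @ F --> (a, b).
Proof. move=> ua vb; exact: (cvg_pair ua vb). Qed.

End Limits.

(** * Limits of bounded sequences along ultrafilters *)

Section UltraLimits.
Variables (R : realType) (T : Type) (F : set_system T).
Context {FU : UltraFilter F}.

(** By compactness of [[-K, K]] the image filter has a cluster point; an ultrafilter contains the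
    preimage of each neighbourhood or of its complement, and clustering excludes the latter. *)
Lemma ultra_cvg_bounded (f : T -> R) K :
  (\forall t \near F, `|f t| <= K) -> exists l : R, f @ F --> l.
Proof.
move=> fK.
have fF : (f @ F) [set` `[- K, K]].
  by apply: filterS fK => t; rewrite /= in_itv /= ler_norml.
have [l [_ cl]] := @segment_compact R (- K) K (f @ F) _ fF.
exists l => A lA.
have [//|FA] := in_ultra_setVsetC (f @^-1` A) FU.
by have [x []] := cl (~` A) A FA lA.
Qed.

Lemma ultra_cvg_dotmul_bounded n (v : T -> 'cV[R]_n) K :
  (\forall t \near F, dotmul (v t) (v t) <= K) ->
  exists l : 'cV[R]_n, v @ F --> l.
Proof.
move=> vK.
have /choice[l lP] i : exists l : R, (fun t => v t i 0) @ F --> l.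
  (* Since [2 |x| <= x ^ 2 + 1], a bound [K] on the square bounds [|x|] by [K + 1]. *)
  apply: (@ultra_cvg_bounded _ (K + 1)); apply: filterS vK => t.
  move=> /(le_trans (sqr_coord_le_dotmul _ i)).
  rewrite -(@real_normK _ (v t i 0)) ?num_real //.
  by have := sqr_ge0 (`|v t i 0| - 1); have := normr_ge0 (v t i 0); nra.
exists (\col_i l i); apply: cvg_mx_coord => i j.
by rewrite mxE ord1; exact: lP.
Qed.

End UltraLimits.

(** * Optimality conditions and energy *)

Section Descent.
Variables (R : realType).
Implicit Type n : nat.

(** [a] is the one-sided derivative at 0; one small [t] suffices to read off its sign. *)
Lemma ge0_of_quadratic (a q : R) :
  (forall t, 0 <= t -> t <= 1 -> 0 <= t * a + t ^+ 2 * q) -> 0 <= a.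
Proof.
move=> H; rewrite leNgt; apply/negP => a0.
(* With this [w] and [t = - a / w], one gets [t <= 1] and [a + t |q| = t (a - 1)], negative when
   [a < 0]. *)
pose w := `|q| - a + 1.
have q0 := normr_ge0 q.
have w0 : 0 < w by rewrite /w; lra.
pose t := - a / w.
have tw : t * w = - a by rewrite /t divfK // gt_eqF.
have t0 : 0 < t by rewrite divr_gt0 // oppr_gt0.
have t1 : t <= 1 by rewrite ler_pdivrMr // mul1r /w; lra.
have := H t (ltW t0) t1.
have -> : t * a + t ^+ 2 * q = t * (a + t * q) by ring.
rewrite pmulr_rge0 // => aq.
have tq : t * q <= t * `|q| by rewrite ler_pM2l // ler_norm.
have : t * (1 - a) <= 0 by rewrite /w in tw; nra.
by rewrite pmulr_rle0 //; lra.
Qed.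

(** Only the quadratic part is differentiated; [f] is handled by convexity on the segment from [z1]
    to [z], so no subgradient appears. The base point [z0] and the weight [gamma] let one statement
    serve the proximal x-steps and the y-step. *)
Lemma argmin_variational m n (f F : 'cV[R]_m -> R) (D : set 'cV[R]_m)
    (A : 'M[R]_(n, m)) (l rho : 'cV[R]_n) (z0 z1 : 'cV[R]_m)
    (C beta gamma : R) :
  @convex_function R 'cV[R]_m setT f -> @convex_set R 'cV[R]_m D ->
  (forall z, F z = C + f z - dotmul l (rho + A *m (z - z0))
     + beta / 2 * enorm (rho + A *m (z - z0)) ^+ 2
     + gamma / 2 * enorm (A *m (z - z0)) ^+ 2) ->
  is_argmin D F z1 ->
  forall z, D z -> f z1 <= f z + dotmul (A *m (z - z1))
    (- l + beta *: (rho + A *m (z1 - z0)) + gamma *: (A *m (z1 - z0))).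
Proof.
move=> cf cD FE [Dz1 minz1] z Dz.
rewrite -subr_ge0; set al := (X in 0 <= X).
pose d := A *m (z - z1).
apply: (@ge0_of_quadratic _ ((beta + gamma) / 2 * dotmul d d)) => t t0 t1.
pose T : {i01 R} := Itv01 t0 t1.
pose zt : 'cV[R]_m := t *: z + (1 - t) *: z1.
have Dzt : D zt by have := cD z z1 T; rewrite !inE => /(_ Dz Dz1).
have fzt : f zt <= t * f z + (1 - t) * f z1.
  by have := cf T z z1; rewrite !inE; apply.
have At : A *m (zt - z0) = A *m (z1 - z0) + t *: d.
  rewrite /d scalemxAr -mulmxDr; congr (_ *m _).
  rewrite /zt scalerBl scale1r scalerBr addrACA.
  by apply/colP => i; rewrite !mxE; ring.
have := minz1 _ Dzt; rewrite !FE At !sqr_enorm /al -/d.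
set e := A *m (z1 - z0).
rewrite !dotmulE (dotmulC e rho) (dotmulC d rho) (dotmulC d l) (dotmulC d e).
by move: fzt; lra.
Qed.

(** The quadratic form with [sigma] on the diagonal and [-1] off it: the price of updating all
    blocks in parallel from the old residual. It is positive definite for [sigma > p - 1]. *)
Definition block_form p n (sigma : R) (a : 'I_p -> 'cV[R]_n) : R :=
  (sigma + 1) * (\sum_i dotmul (a i) (a i)) - dotmul (\sum_i a i) (\sum_i a i).

Lemma block_form_ge p n (sigma : R) (a : 'I_p -> 'cV[R]_n) :
  (sigma + 1 - p%:R) * (\sum_i dotmul (a i) (a i)) <= block_form sigma a.
Proof. by rewrite /block_form; have := dotmul_sum_le a; lra. Qed.

Definition energy p n (sigma tau s : R) (a : 'I_p -> 'cV[R]_n)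
    (b nu : 'cV[R]_n) : R :=
  block_form sigma a + (1 - tau) * dotmul b b + (tau + s)^-1 * dotmul nu nu.

Lemma energy_cvg (T : Type) (F : set_system T) {FF : ProperFilter F} p n
    (sigma tau s : R) (a : T -> 'I_p -> 'cV[R]_n)
    (b nu : T -> 'cV[R]_n) (la : 'I_p -> 'cV[R]_n) (lb lnu : 'cV[R]_n) :
  (forall i, (fun t => a t i) @ F --> la i) -> b @ F --> lb -> nu @ F --> lnu ->
  (fun t => energy sigma tau s (a t) (b t) (nu t)) @ F -->
  energy sigma tau s la lb lnu.
Proof.
move=> al bl nul; rewrite /energy /block_form.
apply: cvgD; last by apply: cvgMl_tmp; exact: cvg_dotmul.
apply: cvgD; last by apply: cvgMl_tmp; exact: cvg_dotmul.
apply: cvgB.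
  by apply: cvgMl_tmp; apply: cvg_sum_ord => i; exact: cvg_dotmul.
by apply: cvg_dotmul; exact: cvg_sum_ord.
Qed.

(** Twice the hypothesis, after the polarization [2 <a', a - a'> = |a|^2 - |a'|^2 - |a - a'|^2]. The
    weight [1 / (tau + s)] is the one for which the [nu] update cancels the product [<nu, r>]. *)
Lemma energy_step p n (sigma tau s : R) (a a' : 'I_p -> 'cV[R]_n)
    (b b' nu r : 'cV[R]_n) :
  0 < tau + s ->
  0 <= \sum_i dotmul (a' i) ((sigma + 1) *: (a i - a' i))
       - dotmul (\sum_i a' i) (\sum_i (a i - a' i))
       + dotmul b' ((1 - tau) *: (b - b') - tau *: r)
       + dotmul (nu + tau *: b - r - (b - b')) r ->
  energy sigma tau s a' b' (nu - (tau + s) *: r)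
  + block_form sigma (fun i => a i - a' i)
  + ((1 - tau) * dotmul (b - b') (b - b') + (2 - tau - s) * dotmul r r
     + 2 * (1 - tau) * dotmul (b - b') r)
  <= energy sigma tau s a b nu.
Proof.
move=> ts0; rewrite /energy /block_form.
have -> : \sum_i dotmul (a' i) ((sigma + 1) *: (a i - a' i)) =
    (sigma + 1) * (\sum_i dotmul (a i) (a i) - \sum_i dotmul (a' i) (a' i)
      - \sum_i dotmul (a i - a' i) (a i - a' i)) / 2.
  rewrite -!sumrB big_distrr big_distrl /=; apply: eq_bigr => i _.
  by rewrite !dotmulE (dotmulC (a i) (a' i)); field.
have -> : (tau + s)^-1 * dotmul (nu - (tau + s) *: r) (nu - (tau + s) *: r)
    = (tau + s)^-1 * dotmul nu nu - 2 * dotmul nu r + (tau + s) * dotmul r r.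
  by rewrite !dotmulE (dotmulC r nu); field; lra.
rewrite !sumrB !dotmulE (dotmulC b b').
rewrite (dotmulC (\sum_i a i) (\sum_i a' i)).
by lra.
Qed.

(* (2 - tau - s) (1 + tau) - (1 - s)^2 is the quadratic polynomial of K_1, so M
   below can be chosen strictly between the two terms; the slack on either side
   gives the decrease in r' and in D. *)
Lemma K1_descent (tau s : R) : calK1 (tau, s) ->
  exists kappa c : R, [/\ 0 <= kappa, 0 < c &
    forall n (D r r' : 'cV[R]_n),
    0 <= (1 + tau) * dotmul D r' + tau * dotmul D D - (1 - s) * dotmul D r ->
    c * (dotmul D D + dotmul r' r') <=
      (1 - tau) * dotmul D D + (2 - tau - s) * dotmul r' r'
      + 2 * (1 - tau) * dotmul D r'
      + kappa * dotmul r r - kappa * dotmul r' r'].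
Proof.
case=> /= ts0 t1 K.
(* Completing the square in [s]: four times the K_1 polynomial plus [(2 s + tau - 1) ^ 2] equals
   [(1 + tau) (5 - 3 tau)]. *)
have tN1 : 0 < 1 + tau.
  have : 0 < (1 + tau) * (5 - 3 * tau).
    by have := sqr_ge0 (2 * s + tau - 1); nra.
  by rewrite pmulr_lgt0 //; lra.
pose B := (1 - s) ^+ 2; pose Q := (2 - tau - s) * (1 + tau).
have BQ : B < Q by rewrite /B /Q; nra.
have B0 : 0 <= B by exact: sqr_ge0.
pose M := (B + Q) / 2.
have M0 : 0 < M by rewrite /M; lra.
(* [c1] is the coefficient left on [|D|^2] once the square in [r] is completed in [sq]. *)
pose c1 := (M - B) * (1 - tau) ^+ 2 / M.
have c10 : 0 < c1.
  by rewrite divr_gt0 // mulr_gt0 ?exprn_gt0 /M; lra.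
pose c := Num.min c1 (Q - M).
have c0 : 0 < c by rewrite lt_min c10 /= /M; lra.
exists (M / (1 + tau)), (c / (1 + tau)); split.
- by rewrite divr_ge0 // ltW.
- by rewrite divr_gt0.
move=> n D r r' cross.
(* After this scaling [kappa] becomes [M], and subtracting [2 (1 - tau)] times [cross] removes
   [<D, r'>]. *)
rewrite -(@ler_pM2l _ (1 + tau)) //.
have cD : c * dotmul D D <= c1 * dotmul D D.
  by rewrite ler_wpM2r ?dotmul_ge0 // ge_min lexx.
have cr : c * dotmul r' r' <= (Q - M) * dotmul r' r'.
  by rewrite ler_wpM2r ?dotmul_ge0 // ge_min lexx orbT.
have sq : c1 * dotmul D D <= (1 - tau) ^+ 2 * dotmul D D
    + 2 * (1 - tau) * (1 - s) * dotmul D r + M * dotmul r r.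
  rewrite -(@ler_pM2l _ M) //.
  have -> : M * (c1 * dotmul D D) = (M - B) * (1 - tau) ^+ 2 * dotmul D D.
    by rewrite /c1; field; lra.
  have := dotmul_ge0 (((1 - s) * (1 - tau)) *: D + M *: r).
  by rewrite !dotmulE (dotmulC r D) /B; nra.
have -> : (1 + tau) * (c / (1 + tau) * (dotmul D D + dotmul r' r'))
    = c * dotmul D D + c * dotmul r' r' by field; lra.
have -> : (1 + tau) * ((1 - tau) * dotmul D D + (2 - tau - s) * dotmul r' r'
      + 2 * (1 - tau) * dotmul D r' + M / (1 + tau) * dotmul r r
      - M / (1 + tau) * dotmul r' r')
   = (1 - tau) ^+ 2 * dotmul D D + 2 * (1 - tau) * (1 - s) * dotmul D r
     + M * dotmul r r + (Q - M) * dotmul r' r'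
     + 2 * (1 - tau) * ((1 + tau) * dotmul D r' + tau * dotmul D D
                        - (1 - s) * dotmul D r).
  by rewrite /Q; field; lra.
have := mulr_ge0 (ltW (_ : 0 < 1 - tau)) cross.
rewrite subr_gt0 => /(_ t1).
by lra.
Qed.

(** A monotone sequence bounded below converges, and [delta k] is squeezed between 0 and the
    consecutive differences of [Phi]. *)
Lemma cvg0_of_decrease (Phi delta : nat -> R) :
  (forall k, 0 <= Phi k) -> (forall k, 0 <= delta k) ->
  (forall k, Phi k.+1 + delta k <= Phi k) ->
  cvgn Phi /\ delta @ \oo --> (0 : R).
Proof.
move=> Phi0 delta0 dec.
have Phicv : cvgn Phi.
  apply: nonincreasing_is_cvgn; last by exists 0 => _ [k _ <-].
  apply/nonincreasing_seqP => k; apply: le_trans (dec k).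
  by rewrite lerDl.
split => //.
apply: (@squeeze_cvgr _ _ _ _ (cst 0) (fun k => Phi k - Phi k.+1)).
- by apply: nearW => k /=; rewrite delta0 lerBrDl dec.
- exact: cvg_cst.
rewrite -(subrr (limn Phi)); apply: cvgB => //.
by rewrite (cvg_shiftS Phi).
Qed.

End Descent.

(** * Saddle points *)

Section Problem.
Variables (R : realType) (p n d : nat) (m : 'I_p -> nat).
Variable P : admm_data R n d m.
Implicit Types x : 'cV[R]_(\sum_i m i).
Implicit Types w ws : 'cV[R]_(\sum_i m i + d + n).

Lemma calA_mul x : calA P *m x = \sum_i mat_x P i *m submxcol x i.
Proof. by rewrite -{1}(submxcolK x) mul_mxrow_mxcol. Qed.

Lemma residualB x x' y y' : residual P x y - residual P x' y' =
  \sum_i mat_x P i *m (submxcol x i - submxcol x' i) + mat_y P *m (y - y').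
Proof.
rewrite /residual !calA_mul.
under [in RHS]eq_bigr do rewrite mulmxBr.
rewrite sumrB mulmxBr; apply/colP => i; rewrite !mxE; ring.
Qed.

Lemma submxcol_set_block x i (z : 'cV[R]_(m i)) j :
  submxcol (set_block x z) j = dfwith (submxcol x) i z j.
Proof. by rewrite mxcolK. Qed.

Lemma residual_set_block x i (z : 'cV[R]_(m i)) y :
  residual P (set_block x z) y =
  residual P x y + mat_x P i *m (z - submxcol x i).
Proof.
apply/eqP; rewrite addrC -subr_eq residualB subrr mulmx0 addr0; apply/eqP.
rewrite (bigD1 i) //= submxcol_set_block dfwithin big1 ?addr0 // => j ji.
by rewrite submxcol_set_block dfwithout 1?eq_sym // subrr mulmx0.
Qed.

Lemma objective_col_mx x y : objective P (col_mx x y) =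
  \sum_i fun_x P i (submxcol x i) + fun_y P y.
Proof. by rewrite /objective col_mxKu col_mxKd. Qed.

Lemma objective_set_block x i (z : 'cV[R]_(m i)) y :
  objective P (col_mx (set_block x z) y) = fun_x P i z +
  (\sum_(j | j != i) fun_x P j (submxcol x j) + fun_y P y).
Proof.
rewrite objective_col_mx (bigD1 i) //= submxcol_set_block dfwithin -addrA.
congr (_ + (_ + _)); apply: eq_bigr => j ji.
by rewrite submxcol_set_block dfwithout // eq_sym.
Qed.

Lemma x_of_wstack x y l : x_of (wstack x y l : 'cV[R]_(\sum_i m i + d + n)) = x.
Proof. by rewrite /x_of /u_of /wstack !col_mxKu. Qed.

Lemma y_of_wstack x y l : y_of (wstack x y l : 'cV[R]_(\sum_i m i + d + n)) = y.
Proof. by rewrite /y_of /u_of /wstack col_mxKu col_mxKd. Qed.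

Lemma l_of_wstack x y l : l_of (wstack x y l : 'cV[R]_(\sum_i m i + d + n)) = l.
Proof. by rewrite /l_of /wstack col_mxKd. Qed.

Lemma wstackK w :
  wstack (x_of w) (y_of w) (l_of w) = w.
Proof. by rewrite /wstack /x_of /y_of /l_of /u_of !vsubmxK. Qed.

Lemma objective_u_of w :
  objective P (u_of w) =
  \sum_i fun_x P i (submxcol (x_of w) i) + fun_y P (y_of w).
Proof. by []. Qed.

(** The transposes move across the product, so the primal blocks enter only through residuals. *)
Lemma dotmul_calJ w ws :
  dotmul (w - ws) (calJ P ws) =
  dotmul (l_of w - l_of ws) (residual P (x_of ws) (y_of ws))
  - dotmul (residual P (x_of w) (y_of w) - residual P (x_of ws) (y_of ws))
      (l_of ws).
Proof.
have -> : w - ws =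
    wstack (x_of w - x_of ws) (y_of w - y_of ws) (l_of w - l_of ws).
  rewrite /x_of /y_of /l_of /u_of -!linearB /=.
  exact/esym/wstackK.
rewrite /calJ /wstack !dotmul_col_mx !dotmulNr !dotmul_mulmx.
have -> : residual P (x_of w) (y_of w) - residual P (x_of ws) (y_of ws) =
    calA P *m (x_of w - x_of ws) + mat_y P *m (y_of w - y_of ws).
  by rewrite /residual !mulmxBr; apply/colP => i; rewrite !mxE; ring.
by rewrite !dotmulDl; ring.
Qed.

(** The multiplier is free in [calM]: shifting it by minus the residual makes the variational
    inequality read [0 <= - |rs|^2]. *)
Lemma Mstar_residual ws : Mstar P ws -> residual P (x_of ws) (y_of ws) = 0.
Proof.
case=> [[Xs Ys]] H; apply: dotmul_eq0; rewrite -oppr_ge0.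
set rs := residual _ _ _.
pose w := wstack (x_of ws) (y_of ws) (l_of ws - rs).
have Mw : calM P w by split; rewrite ?x_of_wstack ?y_of_wstack.
have := H w Mw.
rewrite dotmul_calJ !objective_u_of !(x_of_wstack, y_of_wstack, l_of_wstack).
by rewrite -/rs !subrr dotmul0l add0r subr0 addrAC subrr add0r dotmulNl.
Qed.

(** As the residual at [ws] vanishes, the variational inequality reduces to minimality of the
    Lagrangian with multiplier [l_of ws]. *)
Lemma Mstar_saddle ws w : Mstar P ws -> calM P w ->
  objective P (u_of ws) <=
  objective P (u_of w) - dotmul (residual P (x_of w) (y_of w)) (l_of ws).
Proof.
move=> Ms Mw; have := Ms.2 _ Mw.
by rewrite dotmul_calJ (Mstar_residual Ms) dotmul0r subr0; lra.
Qed.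

(** The objective is separable and the residual affine, so the blockwise inequalities add up. Limits
    of the first-order conditions have this form. *)
Lemma Mstar_of_blocks ws : calM P ws ->
  residual P (x_of ws) (y_of ws) = 0 ->
  (forall i z, dom_x P i z -> fun_x P i (submxcol (x_of ws) i) <=
     fun_x P i z
     - dotmul (mat_x P i *m (z - submxcol (x_of ws) i)) (l_of ws)) ->
  (forall z, dom_y P z -> fun_y P (y_of ws) <=
     fun_y P z - dotmul (mat_y P *m (z - y_of ws)) (l_of ws)) ->
  Mstar P ws.
Proof.
move=> Ms rs0 Hx Hy; split => // w [Xw Yw].
rewrite dotmul_calJ residualB rs0 dotmul0r dotmulDl dotmul_suml !objective_u_of.
have := Hy _ Yw.
have : \sum_i fun_x P i (submxcol (x_of ws) i) <=
    \sum_i (fun_x P i (submxcol (x_of w) i) - dotmul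
      (mat_x P i *m (submxcol (x_of w) i - submxcol (x_of ws) i)) (l_of ws)).
  by apply: ler_sum => i _; exact: Hx (Xw i).
by rewrite sumrB; lra.
Qed.

End Problem.

(** * Convergence of the iterates *)

Section Run.
Variables (R : realType) (p n d : nat) (m : 'I_p -> nat).
Variable P : admm_data R n d m.
Hypothesis f_convex :
  forall i, @convex_function R 'cV[R]_(m i) setT (fun_x P i).
Hypothesis g_convex : @convex_function R 'cV[R]_d setT (fun_y P).
Hypothesis X_convex : forall i, @convex_set R 'cV[R]_(m i) (dom_x P i).
Hypothesis Y_convex : @convex_set R 'cV[R]_d (dom_y P).
Variables (beta sigma tau s : R).
Hypothesis beta_gt0 : 0 < beta.
Variable w : nat -> 'cV[R]_(\sum_i m i + d + n).
Hypothesis w_run : gs_admm_a P beta sigma tau s w.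

Let X k i := submxcol (x_of (w k)) i.
Let Y k := y_of (w k).
Let L k := l_of (w k).
Let r k := residual P (x_of (w k)) (y_of (w k)).
Let DX k i := mat_x P i *m (X k i - X k.+1 i).
Let DY k := mat_y P *m (Y k - Y k.+1).
Let Lt k := l_of (wtilde P beta w k).

(** * Feasibility, residual identities and first-order conditions along the run *)

Lemma run_calM k : calM P (w k).
Proof.
case: k => [|k]; first exact: w_run.1.
by have [xk [yk _] _] := w_run.2 k; split => // i; have [] := xk i.
Qed.

Lemma residual_half k : residual P (x_of (w k.+1)) (y_of (w k)) = r k.+1 + DY k.
Proof.
apply/eqP; rewrite addrC -subr_eq residualB; apply/eqP.
by rewrite big1 ?add0r // => i _; rewrite subrr mulmx0.
Qed.

Lemma residual_step k : r k = r k.+1 + (\sum_i DX k i + DY k).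
Proof. by apply/eqP; rewrite addrC -subr_eq residualB. Qed.

Lemma l_tilde k : Lt k = L k - beta *: (r k.+1 + DY k).
Proof. by rewrite /Lt l_of_wstack residual_half. Qed.

Lemma l_step k : L k.+1 = L k - beta *: ((tau + s) *: r k.+1 + tau *: DY k).
Proof.
have [_ _] := w_run.2 k; rewrite residual_half -/(L _) -/(L _) -/(r _) => ->.
by apply/colP => i; rewrite !mxE; ring.
Qed.

(** A block step sees the old residual. Rewriting it by [residual_step] turns the multiplier into
    [Lt k], the same for all blocks, at the cost of the sum of all block steps. *)
Lemma x_variational k i z : dom_x P i z ->
  fun_x P i (X k.+1 i) <= fun_x P i z + dotmul (mat_x P i *m (z - X k.+1 i))
    (- Lt k + beta *: (\sum_j DX k j - (sigma + 1) *: DX k i)).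
Proof.
move=> Xz; have [/(_ i) + _ _] := w_run.2 k.
rewrite -/(X _ _) -/(X _ _).
move=> /(argmin_variational (f_convex (i := i)) (X_convex (i := i))
  (A := mat_x P i) (l := L k) (rho := r k) (z0 := X k i)
  (C := \sum_(j | j != i) fun_x P j (X k j) + fun_y P (Y k))
  (beta := beta) (gamma := sigma * beta)) H.
apply: le_trans (H _ _ Xz) _.
  move=> z'; rewrite /aug_lagrangian objective_set_block residual_set_block.
  rewrite -/(X _ _) -/(r _) -/(L _) -/(Y _).
  by congr (_ - _ + _ + _); rewrite addrC.
rewrite lerD2l le_eqVlt; apply/orP; left; apply/eqP; congr dotmul.
have -> : mat_x P i *m (X k.+1 i - X k i) = - DX k i.
  by rewrite -mulmxN opprB.
by rewrite l_tilde (residual_step k); apply/colP => j; rewrite !mxE; ring.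
Qed.

Lemma y_variational k z : dom_y P z ->
  fun_y P (Y k.+1) <= fun_y P z + dotmul (mat_y P *m (z - Y k.+1))
    (- Lt k + beta *: (tau *: r k.+1 - (1 - tau) *: DY k)).
Proof.
move=> Yz; have [_ + _] := w_run.2 k.
rewrite residual_half -/(Y _) -/(L _).
set lh := _ - _ => Hmin.
(* The expansion is centred at the minimizer itself, so its increments vanish, and [gamma = 0] as
   the y-step has no proximal term. *)
have H := argmin_variational g_convex Y_convex
  (A := mat_y P) (l := lh) (rho := r k.+1) (z0 := Y k.+1)
  (C := \sum_i fun_x P i (X k.+1 i)) (beta := beta) (gamma := 0) _ Hmin.
apply: le_trans (H _ _ Yz) _.
  move=> z'; rewrite /aug_lagrangian objective_col_mx mul0r mul0r addr0.
  have -> : residual P (x_of (w k.+1)) z' = r k.+1 + mat_y P *m (z' - Y k.+1).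
    apply/eqP; rewrite addrC -subr_eq residualB; apply/eqP.
    by rewrite big1 ?add0r // => i _; rewrite subrr mulmx0.
  by [].
rewrite lerD2l le_eqVlt; apply/orP; left; apply/eqP; congr dotmul.
rewrite subrr mulmx0 addr0 scaler0 addr0 l_tilde /lh.
by apply/colP => j; rewrite !mxE; ring.
Qed.

(* Sum of the conditions for y^{k+1} and y^{k+2}, each tested at the other. *)
Lemma cross_term k : 0 <= (1 + tau) * dotmul (DY k.+1) (r k.+2)
  + tau * dotmul (DY k.+1) (DY k.+1) - (1 - s) * dotmul (DY k.+1) (r k.+1).
Proof.
have H2 := y_variational k.+1 (run_calM k.+1).2.
have := y_variational k (run_calM k.+2).2.
have -> : mat_y P *m (y_of (w k.+2) - Y k.+1) = - DY k.+1.
  by rewrite -mulmxN opprB.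
(* By [l_step] the terms in [DY k] of the two conditions cancel, leaving only [DY k.+1] and two
   residuals. *)
move: H2; rewrite -/(Y _) -/(Y _) -/(DY _) !l_tilde l_step => H2 H1.
rewrite -(pmulr_rge0 _ beta_gt0).
by move: H1 H2; rewrite !dotmulE; lra.
Qed.

Implicit Type ws : 'cV[R]_(\sum_i m i + d + n).

Let errx ws k i := mat_x P i *m (X k i - submxcol (x_of ws) i).
Let erry ws k := mat_y P *m (Y k - y_of ws).
(* With the shear by tau, the energy has no mixed term in (b, lambda). *)
Let errl ws k := beta^-1 *: (L k - l_of ws) - tau *: erry ws k.

(** * Energy decrease relative to a fixed saddle point *)

Section Anchor.
Variable ws : 'cV[R]_(\sum_i m i + d + n).
Hypothesis ws_Mstar : Mstar P ws.

Let a := errx ws.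
Let b := erry ws.
Let nu := errl ws.

(** The conditions at [w k.+1], tested at [ws], and the saddle inequality, tested at [w k.+1], are
    added: the objective values cancel and, after division by [beta], the hypothesis of
    [energy_step] remains. *)
Lemma run_energy_step k : 0 < tau + s ->
  energy sigma tau s (a k.+1) (b k.+1) (nu k.+1)
  + block_form sigma (DX k)
  + ((1 - tau) * dotmul (DY k) (DY k) + (2 - tau - s) * dotmul (r k.+1) (r k.+1)
     + 2 * (1 - tau) * dotmul (DY k) (r k.+1))
  <= energy sigma tau s (a k) (b k) (nu k).
Proof.
move=> ts0.
have aB : DX k = fun i => a k i - a k.+1 i.
  apply/funext => i; rewrite /a /errx /DX -mulmxBr; congr (_ *m _).
  by apply/colP => j; rewrite !mxE; ring.
have bB : DY k = b k - b k.+1.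
  rewrite /b /erry /DY -mulmxBr; congr (_ *m _).
  by apply/colP => j; rewrite !mxE; ring.
have nuB : nu k.+1 = nu k - (tau + s) *: r k.+1.
  rewrite /nu /errl -/b l_step bB; apply/colP => j; rewrite !mxE; field.
  exact: lt0r_neq0.
have rE : r k.+1 = \sum_i a k.+1 i + b k.+1.
  by rewrite -residualB (Mstar_residual ws_Mstar) subr0.
rewrite nuB aB bB; apply: energy_step => //.
rewrite -(pmulr_rge0 _ beta_gt0).
have := Mstar_saddle ws_Mstar (run_calM k.+1).
rewrite !objective_u_of -/(r _).
have := y_variational k ws_Mstar.1.2.
have -> : mat_y P *m (y_of ws - Y k.+1) = - b k.+1 by rewrite -mulmxN opprB.
have : \sum_i fun_x P i (X k.+1 i) <= \sum_i (fun_x P i (submxcol (x_of ws) i)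
    + dotmul (mat_x P i *m (submxcol (x_of ws) i - X k.+1 i))
        (- Lt k + beta *: (\sum_j DX k j - (sigma + 1) *: DX k i))).
  by apply: ler_sum => i _; exact: x_variational (ws_Mstar.1.1 i).
rewrite big_split /=.
have -> : \sum_i dotmul (mat_x P i *m (submxcol (x_of ws) i - X k.+1 i))
     (- Lt k + beta *: (\sum_j DX k j - (sigma + 1) *: DX k i)) =
   dotmul (\sum_i a k.+1 i) (Lt k)
   - beta * dotmul (\sum_i a k.+1 i) (\sum_j DX k j)
   + beta * \sum_i dotmul (a k.+1 i) ((sigma + 1) *: DX k i).
  rewrite !dotmul_suml !big_distrr /= -sumrB -big_split /=.
  apply: eq_bigr => i _.
  have -> : mat_x P i *m (submxcol (x_of ws) i - X k.+1 i) = - a k.+1 i.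
    by rewrite -mulmxN opprB.
  by rewrite !dotmulE; ring.
(* Undoing the shear in [nu] turns the last product of [energy_step] into one with the scaled gap
   between the predicted multiplier and that of [ws]. *)
have -> : nu k + tau *: b k - r k.+1 - (b k - b k.+1) =
    beta^-1 *: (Lt k - l_of ws).
  rewrite l_tilde -bB /nu /errl -/b; apply/colP => j; rewrite !mxE; field.
  exact: lt0r_neq0.
rewrite aB -bB /=.
have -> : dotmul (beta^-1 *: (Lt k - l_of ws)) (r k.+1) =
    beta^-1 * (dotmul (\sum_i a k.+1 i) (Lt k) + dotmul (b k.+1) (Lt k)
      - dotmul (r k.+1) (l_of ws)).
  rewrite dotmulZl dotmulDl dotmulNl dotmulC (dotmulC (l_of ws)).
  by rewrite {1}rE dotmulDl.
move: (r k.+1) => rr; set V := beta^-1 * _.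
have : beta * V = dotmul (\sum_i a k.+1 i) (Lt k) + dotmul (b k.+1) (Lt k)
    - dotmul rr (l_of ws) by rewrite mulVKf ?gt_eqF.
by move: V => V; rewrite !dotmulE; lra.
Qed.

End Anchor.

(** * Lyapunov function and vanishing steps on K_1 *)

Hypothesis sigma_gt : p%:R - 1 < sigma.
Hypothesis tau_s_K1 : calK1 (tau, s).

(** All three terms of the energy are nonnegative here, so a bound on the energy bounds each error
    separately. *)
Lemma energy_ge (a : 'I_p -> 'cV[R]_n) (b nu : 'cV[R]_n) :
  [/\ forall i,
        (sigma + 1 - p%:R) * dotmul (a i) (a i) <= energy sigma tau s a b nu,
      (1 - tau) * dotmul b b <= energy sigma tau s a b nu,
      (tau + s)^-1 * dotmul nu nu <= energy sigma tau s a b nu &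
      0 <= energy sigma tau s a b nu].
Proof.
have [/= ts0 t1 _] := tau_s_K1.
have sp0 : 0 <= sigma + 1 - p%:R by move: sigma_gt; lra.
have b0 : 0 <= (1 - tau) * dotmul b b.
  by rewrite mulr_ge0 ?dotmul_ge0 ?subr_ge0 1?ltW.
have nu0 : 0 <= (tau + s)^-1 * dotmul nu nu.
  by rewrite mulr_ge0 ?dotmul_ge0 ?invr_ge0 ?ltW.
have ai0 i : 0 <= (sigma + 1 - p%:R) * dotmul (a i) (a i).
  by rewrite mulr_ge0 ?dotmul_ge0.
have aS i : (sigma + 1 - p%:R) * dotmul (a i) (a i) <= block_form sigma a.
  apply: le_trans (block_form_ge _ _); rewrite ler_wpM2l //.
  rewrite (bigD1 i) //= lerDl; apply: sumr_ge0 => j _; exact: dotmul_ge0.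
have a0 : 0 <= block_form sigma a.
  apply: le_trans (block_form_ge _ _); rewrite mulr_ge0 //.
  by apply: sumr_ge0 => j _; exact: dotmul_ge0.
by rewrite /energy; split=> [i|||]; [have := aS i| | |]; lra.
Qed.

Let stepx2 k := \sum_i dotmul (DX k i) (DX k i).

(** The term [kappa |r|^2] stores the previous residual that [K1_descent] consumes, so that the
    combined quantity decreases. *)
Lemma run_lyapunov ws : Mstar P ws ->
  exists2 kappa, 0 <= kappa &
    let E k := energy sigma tau s (errx ws k) (erry ws k) (errl ws k)
               + kappa * dotmul (r k) (r k) in
    [/\ forall k, E k.+1 <= E 1, cvgn E,
        stepx2 @ \oo --> (0 : R),
        DY @ \oo --> (0 : 'cV[R]_n) &
        r @ \oo --> (0 : 'cV[R]_n)].
Proof.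
move=> Ms; have [/= ts0 t1 _] := tau_s_K1.
have [kappa [c [kappa0 c0 desc]]] := K1_descent tau_s_K1.
exists kappa => //= ; set E := fun k => _.
pose delta k := block_form sigma (DX k.+1)
  + c * (dotmul (DY k.+1) (DY k.+1) + dotmul (r k.+2) (r k.+2)).
(* The decrease starts at index 1: [cross_term] compares two successive y-minimizers, and the
   initial y need not be one. *)
have Edec k : E k.+2 + delta k <= E k.+1.
  have := run_energy_step Ms k.+1 ts0; have := desc _ _ _ _ (cross_term k).
  by rewrite /E /delta -/(errx ws) -/(erry ws) -/(errl ws); lra.
have E0 k : 0 <= E k.
  rewrite addr_ge0 ?mulr_ge0 ?dotmul_ge0 //.
  by have [] := energy_ge (errx ws k) (erry ws k) (errl ws k).
have sp0 : 0 < sigma + 1 - p%:R by move: sigma_gt; lra.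
have stepx2_ge0 k : 0 <= stepx2 k by apply: sumr_ge0 => j _; exact: dotmul_ge0.
have dd0 k : 0 <= c * dotmul (DY k.+1) (DY k.+1) /\
    0 <= c * dotmul (r k.+2) (r k.+2).
  by rewrite !mulr_ge0 ?dotmul_ge0 ?(ltW c0).
have bf k : (sigma + 1 - p%:R) * stepx2 k.+1 <= block_form sigma (DX k.+1).
  exact: block_form_ge.
have bf0 k : 0 <= (sigma + 1 - p%:R) * stepx2 k by rewrite mulr_ge0 // ltW.
have delta0 k : 0 <= delta k.
  by rewrite /delta mulrDr; have := dd0 k; have := bf k; have := bf0 k.+1; lra.
have [Ecvg delta_cvg] := cvg0_of_decrease (fun k => E0 k.+1) delta0 Edec.
split.
- elim=> [|k IH] //; apply: le_trans IH; apply: le_trans (Edec k).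
  by rewrite lerDl.
- have /cvg_ex[l El] := Ecvg; apply/cvg_ex; exists l.
  by rewrite -(cvg_shiftS E).
- rewrite -(cvg_shiftS stepx2); apply: (cvg0_le_scaled sp0 _ _ delta_cvg) => k.
    exact: stepx2_ge0.
  apply: (le_trans (bf k)).
  by rewrite /delta mulrDr; have := dd0 k; lra.
- rewrite -(cvg_shiftS DY); apply: cvg_dotmul0.
  apply: (cvg0_le_scaled c0 _ _ delta_cvg) => k; first exact: dotmul_ge0.
  rewrite /delta mulrDr /=.
  by have := dd0 k; have := bf k; have := bf0 k.+1; lra.
- rewrite -(cvg_shiftS r) -(cvg_shiftS (fun k => r k.+1)); apply: cvg_dotmul0.
  apply: (cvg0_le_scaled c0 _ _ delta_cvg) => k; first exact: dotmul_ge0.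
  rewrite /delta mulrDr /=.
  by have := dd0 k; have := bf k; have := bf0 k.+1; lra.
Qed.

(** * Recovery of the iterates and identification of their limits *)

Hypothesis f_closed : forall i, closed (epigraph (fun_x P i)).
Hypothesis g_closed : closed (epigraph (fun_y P)).
Hypothesis X_closed : forall i, closed (dom_x P i).
Hypothesis Y_closed : closed (dom_y P).
Variables (CA : forall i, 'M[R]_(m i, n)) (CB : 'M[R]_(d, n)).
Hypothesis CA_mul : forall i, CA i *m mat_x P i = 1%:M.
Hypothesis CB_mul : CB *m mat_y P = 1%:M.

(** Left inverses recover [x_i] and [y] from their images under [A_i] and [B]; undoing the shear
    recovers the multiplier. The filter is left general to cover both an ultrafilter and [\oo]. *)
Lemma iterates_cvg (F : set_system nat) {FF : ProperFilter F} ws lx ly ll :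
  (forall i, (fun k => errx ws k i) @ F --> (lx i : 'cV[R]_n)) ->
  erry ws @ F --> (ly : 'cV[R]_n) -> errl ws @ F --> (ll : 'cV[R]_n) ->
  [/\ forall i, (fun k => X k i) @ F --> submxcol (x_of ws) i + CA i *m lx i,
      Y @ F --> y_of ws + CB *m ly &
      L @ F --> l_of ws + beta *: (ll + tau *: ly)].
Proof.
move=> axl ayl all; split=> [i||].
- rewrite [X in X @ _](_ : _ =
      fun k => submxcol (x_of ws) i + CA i *m errx ws k i).
    by apply: cvgD; [exact: cvg_cst|exact: cvg_mulmx].
  by apply/funext => k; rewrite /errx mulmxA CA_mul mul1mx addrC subrK.
- rewrite [X in X @ _](_ : _ = fun k => y_of ws + CB *m erry ws k).
    by apply: cvgD; [exact: cvg_cst|exact: cvg_mulmx].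
  by apply/funext => k; rewrite /erry mulmxA CB_mul mul1mx addrC subrK.
- rewrite [X in X @ _](_ : _ =
      fun k => l_of ws + beta *: (errl ws k + tau *: erry ws k)).
    apply: cvgD; first exact: cvg_cst.
    by apply: cvg_scalemx; apply: cvgD => //; exact: cvg_scalemx.
  apply/funext => k; rewrite /errl subrK scalerA mulfV ?gt_eqF // scale1r.
  by rewrite addrC subrK.
Qed.

Section NullSteps.
Hypothesis stepx2_cvg0 : stepx2 @ \oo --> (0 : R).
Hypothesis DY_cvg0 : DY @ \oo --> (0 : 'cV[R]_n).
Hypothesis r_cvg0 : r @ \oo --> (0 : 'cV[R]_n).

Lemma DX_cvg0 i : (fun k => DX k i) @ \oo --> (0 : 'cV[R]_n).
Proof.
apply: cvg_dotmul0; apply: (cvg0_le_scaled ltr01 _ _ stepx2_cvg0) => k.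
  exact: dotmul_ge0.
rewrite mul1r /stepx2 (bigD1 i) //= lerDl.
by apply: sumr_ge0 => j _; exact: dotmul_ge0.
Qed.

(** Consecutive primal iterates differ by images of vanishing steps under the left inverses, and
    [Lt k] differs from [L k] by a vanishing term; null limits along [\oo] pass to any finer
    filter. *)
Lemma tilde_cvg (F : set_system nat) {FF : ProperFilter F} lx ly ll :
  \oo `<=` F ->
  (forall i, (fun k => X k i) @ F --> (lx i : 'cV[R]_(m i))) ->
  Y @ F --> (ly : 'cV[R]_d) -> L @ F --> (ll : 'cV[R]_n) ->
  [/\ forall i, (fun k => X k.+1 i) @ F --> lx i,
      (fun k => Y k.+1) @ F --> ly & Lt @ F --> ll].
Proof.
move=> FO Xl Yl Ll.
have Fcvg (V : topologicalType) (v : nat -> V) (l : V) :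
    v @ \oo --> l -> v @ F --> l by move=> vl B /vl; exact: FO.
have rS : (fun k => r k.+1) @ F --> (0 : 'cV[R]_n).
  by apply: Fcvg; rewrite (cvg_shiftS r).
split=> [i||].
- rewrite [X in X @ _](_ : _ = fun k => X k i - CA i *m DX k i).
    rewrite -[lx i]subr0 -(mulmx0 _ (CA i)); apply: cvgB; first exact: Xl.
    by apply: cvg_mulmx; apply: Fcvg; exact: DX_cvg0.
  by apply/funext => k; rewrite /DX mulmxA CA_mul mul1mx subKr.
- rewrite [X in X @ _](_ : _ = fun k => Y k - CB *m DY k).
    rewrite -[ly]subr0 -(mulmx0 _ CB); apply: cvgB => //.
    by apply: cvg_mulmx; exact: Fcvg.
  by apply/funext => k; rewrite /DY mulmxA CB_mul mul1mx subKr.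
- rewrite [X in X @ _](_ : _ = fun k => L k - beta *: (r k.+1 + DY k)).
    rewrite -[ll]subr0 -(scaler0 _ beta) -(addr0 0); apply: cvgB => //.
    by apply: cvg_scalemx; apply: cvgD => //; exact: Fcvg.
  by apply/funext => k; exact: l_tilde.
Qed.

(** The error terms of the first-order conditions vanish in the limit; what survives is the
    hypothesis of [Mstar_of_blocks]. *)
Lemma Mstar_limit (F : set_system nat) {FF : ProperFilter F} lx ly ll :
  \oo `<=` F ->
  (forall i, (fun k => X k i) @ F --> (lx i : 'cV[R]_(m i))) ->
  Y @ F --> (ly : 'cV[R]_d) -> L @ F --> (ll : 'cV[R]_n) ->
  Mstar P (wstack (\mxcol_i lx i) ly ll).
Proof.
move=> FO Xl Yl Ll.
have [XSl YSl Ltl] := tilde_cvg FO Xl Yl Ll.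
have Fcvg (V : topologicalType) (v : nat -> V) (l : V) :
    v @ \oo --> l -> v @ F --> l by move=> vl B /vl; exact: FO.
have rS : (fun k => r k.+1) @ F --> (0 : 'cV[R]_n).
  by apply: Fcvg; rewrite (cvg_shiftS r).
apply: Mstar_of_blocks; rewrite ?(x_of_wstack, y_of_wstack, l_of_wstack).
- split=> [i|]; rewrite ?(x_of_wstack, y_of_wstack).
    rewrite mxcolK.
    apply: (@closed_cvg _ _ F FF _ _ (X_closed (i := i)) _ _ (Xl i)).
    by apply: nearW => k; exact: (run_calM k).1.
  apply: (@closed_cvg _ _ F FF _ _ Y_closed _ _ Yl).
  by apply: nearW => k; exact: (run_calM k).2.
(* [r] tends both to the residual at the limit point and to 0. *)
- have rl : r @ F --> residual P (\mxcol_i lx i) ly.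
    rewrite /r /residual; apply: cvgB; last exact: cvg_cst.
    apply: cvgD; last exact: cvg_mulmx.
    apply: cvg_mulmx.
    rewrite [X in X @ _](_ : _ = fun k => \mxcol_i X k i).
      exact: cvg_mxcol.
    by apply/funext => k; rewrite submxcolK.
  exact: (cvg_unique (@norm_hausdorff _ _) rl (Fcvg _ _ _ r_cvg0)).
- move=> i z Xz; rewrite mxcolK -dotmulNr.
  (* The condition is read as membership in the epigraph, whose closedness acts as lower
     semicontinuity of [fun_x P i]. *)
  have : epigraph (fun_x P i) (lx i,
      fun_x P i z + dotmul (mat_x P i *m (z - lx i)) (- ll)).
    apply: (@closed_cvg _ _ F FF (fun k => (X k.+1 i, fun_x P i z +
      dotmul (mat_x P i *m (z - X k.+1 i))
        (- Lt k + beta *: (\sum_j DX k j - (sigma + 1) *: DX k i))))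
      _ (f_closed (i := i))).
      by apply: nearW => k; exact: x_variational.
    apply: cvg_pair_nbhs; first exact: XSl.
    apply: cvgD; first exact: cvg_cst.
    apply: cvg_dotmul.
      by apply: cvg_mulmx; apply: cvgB; [exact: cvg_cst|exact: XSl].
    rewrite -[- ll]addr0; apply: cvgD; first exact: cvgN.
    have : (fun k => beta *: (\sum_j DX k j - (sigma + 1) *: DX k i)) @ F -->
        beta *: (\sum_(j < p) (0 : 'cV[R]_n) - (sigma + 1) *: (0 : 'cV[R]_n)).
      have DX0 j : (fun k => DX k j) @ F --> (0 : 'cV[R]_n).
        by apply: Fcvg; exact: DX_cvg0.
      apply: cvg_scalemx; apply: cvgB; last exact: cvg_scalemx.
      by apply: cvg_sum_ord => j; exact: DX0.
    by rewrite big1 // scaler0 subr0 scaler0.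
  by [].
- move=> z Yz; rewrite -dotmulNr.
  have : epigraph (fun_y P) (ly,
      fun_y P z + dotmul (mat_y P *m (z - ly)) (- ll)).
    apply: (@closed_cvg _ _ F FF (fun k => (Y k.+1, fun_y P z +
      dotmul (mat_y P *m (z - Y k.+1))
        (- Lt k + beta *: (tau *: r k.+1 - (1 - tau) *: DY k))))
      _ g_closed).
      by apply: nearW => k; exact: y_variational.
    apply: cvg_pair_nbhs => //.
    apply: cvgD; first exact: cvg_cst.
    apply: cvg_dotmul.
      by apply: cvg_mulmx; apply: cvgB => //; exact: cvg_cst.
    rewrite -[- ll]addr0; apply: cvgD; first exact: cvgN.
    have : (fun k => beta *: (tau *: r k.+1 - (1 - tau) *: DY k)) @ F -->
        beta *: (tau *: (0 : 'cV[R]_n) - (1 - tau) *: (0 : 'cV[R]_n)).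
      apply: cvg_scalemx; apply: cvgB; apply: cvg_scalemx => //.
      exact: Fcvg.
    by rewrite !scaler0 subr0 scaler0.
  by [].
Qed.

End NullSteps.

Lemma run_converges ws0 : Mstar P ws0 ->
  [/\ stepx2 @ \oo --> (0 : R), (fun k => enorm (r k)) @ \oo --> (0 : R) &
      exists2 winf, Mstar P winf & wtilde P beta w @ \oo --> winf].
Proof.
move=> Ms0; have [/= ts0 t1 _] := tau_s_K1.
have sp0 : 0 < sigma + 1 - p%:R by move: sigma_gt; lra.
have [kappa kappa0 [bnd _ s2 dy rr]] := run_lyapunov Ms0.
split=> //.
  rewrite -(sqrtr0 R) -(dotmul0l (0 : 'cV[R]_n)).
  exact: cvg_comp (cvg_dotmul rr rr) (@sqrt_continuous R _).
(* Along an ultrafilter every bounded sequence converges, so that no extraction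
   of subsequences is needed. *)
have [U [UU OU]] := @ultraFilterLemma nat \oo _.
have Ucvg (V : topologicalType) (v : nat -> V) (l : V) :
    v @ \oo --> l -> v @ U --> l by move=> vl B /vl; exact: OU.
pose K := energy sigma tau s (errx ws0 1) (erry ws0 1) (errl ws0 1)
  + kappa * dotmul (r 1) (r 1).
have boundK k :
    energy sigma tau s (errx ws0 k.+1) (erry ws0 k.+1) (errl ws0 k.+1) <= K.
  by apply: le_trans (bnd k); rewrite lerDl mulr_ge0 // dotmul_ge0.
have Ubound (v : nat -> 'cV[R]_n) c : 0 < c ->
    (forall k, c * dotmul (v k) (v k) <=
      energy sigma tau s (errx ws0 k) (erry ws0 k) (errl ws0 k)) ->
    exists l : 'cV[R]_n, v @ U --> l.
  move=> c0 vE; apply: (@ultra_cvg_dotmul_bounded _ _ _ _ _ _ (c^-1 * K)).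
  (* Index 0 is discarded, since the energy bound holds from index 1 on. *)
  apply: OU; exists 1 => // -[//|k] _ /=.
  by rewrite ler_pdivlMl //; apply: le_trans (vE _) (boundK k).
have /choice[lx lxP] i : exists l : 'cV[R]_n, (fun k => errx ws0 k i) @ U --> l.
  by apply: (Ubound _ _ sp0) => k; have [/(_ i)] :=
    energy_ge (errx ws0 k) (erry ws0 k) (errl ws0 k).
have [ly lyP] : exists l : 'cV[R]_n, erry ws0 @ U --> l.
  apply: (Ubound _ (1 - tau)) => [|k]; first by rewrite subr_gt0.
  by have [] := energy_ge (errx ws0 k) (erry ws0 k) (errl ws0 k).
have [ll llP] : exists l : 'cV[R]_n, errl ws0 @ U --> l.
  apply: (Ubound _ (tau + s)^-1) => [|k]; first by rewrite invr_gt0.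
  by have [] := energy_ge (errx ws0 k) (erry ws0 k) (errl ws0 k).
have [Xl Yl Ll] := iterates_cvg lxP lyP llP.
have := Mstar_limit s2 dy rr OU Xl Yl Ll.
set xinf := \mxcol_i _; set yinf := _ + _ in Yl *.
set linf := l_of _ + _ in Ll *.
set winf := wstack _ _ _ => /(_ (@ultra_proper _ _ UU)) Minf.
exists winf => //.
(* With the ultrafilter limit as the new anchor, the Lyapunov function converges along [\oo]; its
   limit is computed along [U], where all errors vanish. *)
have [kap kap0 [_ /= Ecvg _ _ _]] := run_lyapunov Minf.
move: Ecvg; set E := fun k => _; move=> /cvg_ex[/= l El].
have EU : E @ U --> (0 : R).
  have -> : (0 : R) = energy sigma tau s (fun _ : 'I_p => 0 : 'cV[R]_n) 0 0
      + kap * dotmul (0 : 'cV[R]_n) 0.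
    rewrite /energy /block_form big1 => [|i _]; last by rewrite dotmul0l.
    by rewrite big1 // !dotmul0l !mulr0 !addr0 subr0.
  apply: cvgD; last by apply: cvgMl_tmp; apply: cvg_dotmul; exact: Ucvg.
  have ay0 : erry winf @ U --> (0 : 'cV[R]_n).
    rewrite -(mulmx0 _ (mat_y P)) -(subrr (y_of winf)); apply: cvg_mulmx.
    by apply: cvgB; [rewrite y_of_wstack|exact: cvg_cst].
  apply: energy_cvg => // [i|].
    rewrite -(mulmx0 _ (mat_x P i)) -(subrr (submxcol (x_of winf) i)).
    apply: cvg_mulmx; apply: cvgB; last exact: cvg_cst.
    by rewrite x_of_wstack /xinf mxcolK; exact: Xl.
  have : errl winf @ U -->
      beta^-1 *: (linf - l_of winf) - tau *: (0 : 'cV[R]_n).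
    apply: cvgB; last exact: cvg_scalemx.
    by apply: cvg_scalemx; apply: cvgB => //; exact: cvg_cst.
  by rewrite l_of_wstack subrr !scaler0 subr0.
have l0 : l = 0.
  exact: (cvg_unique (@norm_hausdorff _ _) (Ucvg _ _ _ El) EU).
(* The energy lies between 0 and [E], so it tends to 0 along [\oo], and with it each error. *)
have En0 : (fun k => energy sigma tau s (errx winf k) (erry winf k)
    (errl winf k)) @ \oo --> (0 : R).
  rewrite l0 in El; apply: (cvg0_le_scaled ltr01 _ _ El) => k.
    by have [] := energy_ge (errx winf k) (erry winf k) (errl winf k).
  by rewrite mul1r lerDl mulr_ge0 // dotmul_ge0.
have null (v : nat -> 'cV[R]_n) c : 0 < c ->
    (forall k, c * dotmul (v k) (v k) <=
      energy sigma tau s (errx winf k) (erry winf k) (errl winf k)) ->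
    v @ \oo --> (0 : 'cV[R]_n).
  move=> c0 vE; apply: cvg_dotmul0; apply: (cvg0_le_scaled c0 _ vE En0) => k.
  exact: dotmul_ge0.
have ax0 i : (fun k => errx winf k i) @ \oo --> (0 : 'cV[R]_n).
  by apply: (null _ _ sp0) => k; have [/(_ i)] :=
    energy_ge (errx winf k) (erry winf k) (errl winf k).
have ay0 : erry winf @ \oo --> (0 : 'cV[R]_n).
  apply: (null _ (1 - tau)) => [|k]; first by rewrite subr_gt0.
  by have [] := energy_ge (errx winf k) (erry winf k) (errl winf k).
have al0 : errl winf @ \oo --> (0 : 'cV[R]_n).
  apply: (null _ (tau + s)^-1) => [|k]; first by rewrite invr_gt0.
  by have [] := energy_ge (errx winf k) (erry winf k) (errl winf k).
have [Xc Yc Lc] := iterates_cvg ax0 ay0 al0.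
have [XSc YSc Ltc] := tilde_cvg s2 dy rr (@subset_refl _ _) Xc Yc Lc.
rewrite -[winf]wstackK -(submxcolK (x_of winf)).
rewrite [X in X @ _](_ : _ =
    fun k => wstack (\mxcol_i X k.+1 i) (Y k.+1) (Lt k)).
  apply: cvg_col_mx; last by move: Ltc; rewrite scaler0 addr0 scaler0 addr0.
  apply: cvg_col_mx; last by move: YSc; rewrite mulmx0 addr0.
  apply: cvg_mxcol => i; by move: (XSc i); rewrite mulmx0 addr0.
by apply/funext => k; rewrite submxcolK /Lt l_of_wstack.
Qed.

End Run.

Theorem theorem9 (R : realType) (p n d : nat) (m : 'I_p -> nat)
    (P : admm_data R n d m)
    (p_ge1 : (1 <= p)%N)
    (f_cpc : forall i, closed_proper_convex (fun_x P i))
    (g_cpc : closed_proper_convex (fun_y P))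
    (A_full_col_rank : forall i, \rank (mat_x P i) = m i)
    (B_full_col_rank : \rank (mat_y P) = d)
    (X_closed : forall i, closed (dom_x P i))
    (X_convex : forall i, @convex_set R 'cV[R]_(m i) (dom_x P i))
    (Y_closed : closed (dom_y P))
    (Y_convex : @convex_set R 'cV[R]_d (dom_y P))
    (solution_nonempty : solution_set P !=set0)
    (Mstar_nonempty : Mstar P !=set0)
    (beta sigma1 tau s : R)
    (beta_gt0 : 0 < beta)
    (sigma1_gt : p%:R - 1 < sigma1)
    (tau_s_K1 : calK1 (tau, s))
    (w : nat -> 'cV[R]_(\sum_i m i + d + n))
    (w_run : gs_admm_a P beta sigma1 tau s w) :
  [/\ (fun k : nat => \sum_i
         enorm (mat_x P i *m (submxcol (x_of (w k)) i
                              - submxcol (x_of (w k.+1)) i)) ^+ 2)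
        @ \oo --> (0 : R),
      (fun k : nat => enorm (residual P (x_of (w k)) (y_of (w k))))
        @ \oo --> (0 : R) &
      exists2 winf, Mstar P winf & wtilde P beta w @ \oo --> winf].
Proof.
(* Rank equal to the number of columns is [row_full], which is equivalent to having a left
   inverse. *)
have CA_ex i : exists C : 'M[R]_(m i, n), C *m mat_x P i = 1%:M.
  by apply/row_fullP; rewrite /row_full A_full_col_rank.
have [CB CB_mul] : exists C : 'M[R]_(d, n), C *m mat_y P = 1%:M.
  by apply/row_fullP; rewrite /row_full B_full_col_rank.
have [ws Ms] := Mstar_nonempty.
have [step_cvg0 res_cvg0 w_cvg] := run_converges
  (fun i => let: And3 _ _ h := f_cpc i in h) (let: And3 _ _ h := g_cpc in h)
  X_convex Y_convex beta_gt0 w_run sigma1_gt tau_s_K1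
  (fun i => let: And3 h _ _ := f_cpc i in h) (let: And3 h _ _ := g_cpc in h)
  X_closed Y_closed (fun i => projT2 (cid (CA_ex i))) CB_mul Ms.
split=> //; under eq_fun do under eq_bigr do rewrite sqr_enorm.
exact: step_cvg0.
Qed.
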